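(* Let $\Gamma$ be a finite metric tree with edges $e_1,\dots,e_E$ having propagation times $t_1,\dots,t_E$ that are linearly independent over $\mathbb{Q}$, and let $A$ be a vertex of $\Gamma$ of valence $n=\deg(A)$. Then for every $T\ge 0$, $$N(\Gamma, A,A,T) = \sum_{G\subseteq E(\Gamma)} c_G\, \#[G],$$ where the coefficient $c_G$ is defined as follows. Number the edges incident to $A$ as $e_1,\dots,e_n$ so that $G$ meets $E(\Gamma_{e_1}),\dots,E(\Gamma_{e_k})$ and is disjoint from $E(\Gamma_{e_{k+1}}),\dots,E(\Gamma_{e_n})$ (with $0\le k\le n$). Then $$ c_G = \prod_{i=1}^k z\big(\Gamma_{e_i}, G\cap E(\Gamma_{e_i}), A\big) \left[ \sum_{j=0}^{n-k-1} (n-k-j)\, \sigma_j(z_{k+1},\dots,z_n) \right],$$ where $z_i=z_i(\Gamma,A)$ and $\sigma_j$ is the $j$-th elementary symmetric polynomial ($\sigma_0=1$).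
   Context: Dynamics on a finite metric tree $\Gamma$: each edge $e_i$ is traversed by a moving point in the fixed time $t_i>0$ (no turning points on edges). At time $0$ the process starts at the vertex $A$ (a point at $A$ departs, one point along each edge incident to $A$). At a vertex of valence one a point is reflected. If $k$ points arrive simultaneously at an interior vertex of valence $v$, then $v$ points leave it, one along each incident edge; the number of new points born at that vertex at that moment is $v-k$. $N(\Gamma,A,X,T)$ denotes the total number of new points born at the vertex $X$ up to the moment $T$, when the process starts at $A$ at time $0$. Notation: $E(\Gamma)$ is the edge set and $|\Gamma|=|E(\Gamma)|$. For a vertex $A$ with incident edges $e_1,\dots,e_n$, $\Gamma_{e_i}$ is the maximal subtree of $\Gamma$ containing $e_i$ and none of the edges $e_j$, $j\neq i$ (the branch of $\Gamma$ at $A$ through $e_i$); thus $\Gamma=\bigcup_i\Gamma_{e_i}$. For a tree $\Gamma$ with a vertex $A$ and an edge set $G\subseteq E(\Gamma)$, $$z(\Gamma,G,A)=(-1)^{|G|}\sum_{\Gamma'}(-1)^{|\Gamma'|},$$ the sum being over all subtrees (connected subgraphs) $\Gamma'\subseteq\Gamma$ containing $A$ and having at least one edge, with $G\subseteq E(\Gamma')$. Also $z_i(\Gamma,A)=z(\Gamma_{e_i},\varnothing,A)$ for $1\le i\le \deg(A)$. For $G=\{e_{i_1},\dots,e_{i_m}\}$, $\#[G]$ is the number of tuples of nonnegative integers $(n_{i_1},\dots,n_{i_m})$ with $2n_{i_1}t_{i_1}+\dots+2n_{i_m}t_{i_m}\le T$; $\#[\varnothing]=1$. *)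

(* Defs.v *)
From HB Require Import structures.
From mathcomp Require Import all_boot all_order all_algebra.
From mathcomp Require Import boolp classical_sets fsbigop reals.
Set Implicit Arguments. Unset Strict Implicit. Unset Printing Implicit Defensive.
Import Order.TTheory GRing.Theory Num.Theory.

Section Graph.
Variables (V Ed : finType) (eu ev : Ed -> V).

Definition inc (e : Ed) (x : V) : bool := (eu e == x) || (ev e == x).

Definition deg (x : V) : nat := #|[set e | inc e x]|.

Definition adjF (F : {set Ed}) : rel V :=
  fun x y => [exists e in F, ((eu e == x) && (ev e == y)) || ((eu e == y) && (ev e == x))].

Definition is_tree : Prop :=
  (forall e, eu e != ev e) /\
  (forall x y : V, connect (adjF (finset.setT : {set Ed})) x y) /\
  #|Ed|.+1 = #|V|.

(* F is (the edge set of) a subtree of Gamma containing A with at least one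
   edge: F nonempty and the subgraph formed by F is connected and contains A. *)
Definition subtreeA (A : V) (F : {set Ed}) : bool :=
  (F != finset.set0) && [forall e in F, connect (adjF F) A (eu e)].

Definition share_notA (A : V) : rel Ed :=
  fun f g => [exists x, (x != A) && inc f x && inc g x].
Definition branch (A : V) (e : Ed) : {set Ed} := [set f | connect (share_notA A) e f].

Definition Aedges (A : V) : {set Ed} := [set e | inc e A].

Definition zz (A : V) (B G : {set Ed}) : int :=
  (-1) ^+ #|G| * \sum_(F : {set Ed} | subtreeA A F && (F \subset B) && (G \subset F))
                    (-1) ^+ #|F|.

Definition zi (A : V) (e : Ed) : int := zz A (branch A e) finset.set0.

Definition esym (A : V) (J : {set Ed}) (j : nat) : int :=
  \sum_(S : {set Ed} | (S \subset J) && (#|S| == j)) \prod_(e in S) zi A e.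

Definition cG (A : V) (G : {set Ed}) : int :=
  let K := [set e in Aedges A | G :&: branch A e != finset.set0] in
  let J := Aedges A :\: K in
  (\prod_(e in K) zz A (branch A e) (G :&: branch A e)) *
  (\sum_(j < #|J|) (#|J| - j)%:Z * esym A J j).

End Graph.

Section Dynamics.
Variables (R : realType) (V Ed : finType) (eu ev : Ed -> V) (t : Ed -> R) (A : V).

(* active x s : at time s, points depart from vertex x along every incident
   edge (at time 0 from A; afterwards whenever some point arrives at x; at a
   leaf this is the reflection). A point departing from one end of e at time s
   arrives at the other end at time s + t e. *)
Inductive active : V -> R -> Prop :=
| active0 : active A 0%R
| active_uv (e : Ed) (s : R) : active (eu e) s -> active (ev e) (s + t e)%R
| active_vu (e : Ed) (s : R) : active (ev e) s -> active (eu e) (s + t e).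

Definition other (e : Ed) (x : V) : V := if eu e == x then ev e else eu e.

Definition arrivals (x : V) (s : R) : nat :=
  #|[set e | inc eu ev e x && `[< active (other e x) (s - t e)%R >]]|.

Definition births (x : V) (s : R) : nat := (deg eu ev x - arrivals x s)%N.

Definition Nbirths (X : V) (T : R) : nat :=
  \big[addn/0%N]_(s \in [set s : R | active X s /\ (s <= T)%R]) births X s.

End Dynamics.

Definition cntG (R : realType) (Ed : finType) (t : Ed -> R) (G : {set Ed}) (T : R) : nat :=
  \big[addn/0%N]_(f \in [set f : {ffun Ed -> nat} |
        (forall e, e \notin G -> f e = 0%N) /\
        (2 * (\sum_(e in G) (f e)%:R * t e) <= T)%R]) 1%N.

Definition Qlin_indep (R : realType) (Ed : finType) (t : Ed -> R) : Prop :=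
  forall q : Ed -> rat, (\sum_(e : Ed) ratr (q e) * t e = 0)%R -> forall e, q e = 0%R.

(* Main.v *)
Require Import Defs.
From HB Require Import structures.
From mathcomp Require Import all_boot all_order all_algebra.
From mathcomp Require Import zify ring lra.
From mathcomp Require Import boolp classical_sets fsbigop reals.
Set Implicit Arguments. Unset Strict Implicit. Unset Printing Implicit Defensive.
Import Order.TTheory GRing.Theory Num.Theory.

(* A vertex A is active at time s iff s is the duration of a closed walk at A.
   In a tree every edge is a bridge, so such a walk uses each edge e an even
   number 2 n_e of times, and its support is a subtree through A; conversely,
   inserting detours realizes every n whose support is empty or such a subtree.
   By linear independence s = 2 sum n_e t_e determines n, and the number of
   points born at A at time s is the number of edges e at A with n_e = 0.

   The branches at A cut a subtree F through A into independent pieces, and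
   expanding the product over the branches gives
     c_G = sum_(F containing G) (-1)^(|F| + |G|) #{e at A | e not in F},
   F running over the subtrees through A, the empty one included.  Moebius
   inversion turns this into
     sum_(G containing S) c_G = #{e at A | e not in S}
   for S a subtree through A or empty, and 0 for the other S.  Summing over the
   supports S of all n with 2 sum n_e t_e <= T gives the formula. *)

(** * Paths of a finite relation *)

Lemma connect_ind (T : finType) (e : rel T) (P : T -> Prop) (x y : T) :
  P x -> (forall u v, P u -> e u v -> P v) -> connect e x y -> P y.
Proof.
move=> Px Pe /connectP[p + ->]; elim: p x Px => //= z p IH x Px /andP[xz zp].
exact: IH (Pe _ _ Px xz) zp.
Qed.

Lemma connect_exit (T : finType) (e : rel T) (W : {set T}) (x y : T) :
  connect e x y -> x \in W -> y \notin W ->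
  exists u v, [/\ u \in W, v \notin W & e u v].
Proof.
move=> xy xW; apply: contraNP => noexit.
apply: (connect_ind (P := fun z => z \in W)) xy => // u v uW uv.
by apply: contra_notT noexit => vW; exists u, v.
Qed.

(** * Walks and bridges in trees *)

Section Graph.
Variables (V Ed : finType) (eu ev : Ed -> V).
Implicit Types (e f g : Ed) (x y z : V) (F G B : {set Ed}) (p q : seq Ed).
Local Notation inc := (inc eu ev).
Local Notation other := (other eu ev).
Local Notation adjF := (adjF eu ev).

Lemma inc_other e x : inc e x -> inc e (other e x).
Proof. by rewrite /inc /other; case: eqP => _ _; rewrite eqxx ?orbT. Qed.

Lemma otherK e x : inc e x -> other e (other e x) = x.
Proof.
rewrite /inc /other; case: (eqVneq (eu e) x) => [<- _|_ /= /eqP<-].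
  by case: eqP => [->|].
by rewrite eqxx.
Qed.

Lemma inc_cases e x y : inc e x -> inc e y -> y = x \/ y = other e x.
Proof.
rewrite /inc /other => /orP[/eqP<-|/eqP<-] /orP[/eqP<-|/eqP<-]; rewrite ?eqxx; auto.
by case: eqP; auto.
Qed.

Lemma adjFP F x y :
  reflect (exists2 e, e \in F & inc e x /\ other e x = y) (adjF F x y).
Proof.
apply: (iffP existsP) => [[e /andP[eF H]]|[e eF [ix <-]]]; exists e => //.
  rewrite /inc /other; case/orP: H => /andP[/eqP-> /eqP->]; rewrite eqxx ?orbT //.
  by case: eqP.
rewrite eF /=; move: ix; rewrite /inc /other.
by case: (eqVneq (eu e) x) => //= _; rewrite eqxx ?andbT.
Qed.

Lemma adjF_sym F : symmetric (adjF F).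
Proof.
by move=> x y; apply/adjFP/adjFP => -[e eF [ix <-]];
  exists e => //; rewrite inc_other // otherK.
Qed.

Lemma connect_adjF_sym F : connect_sym (adjF F).
Proof. exact/sym_connect_sym/adjF_sym. Qed.

Lemma connect_other F e x :
  e \in F -> inc e x -> connect (adjF F) x (other e x).
Proof. by move=> eF ix; apply/connect1/adjFP; exists e. Qed.

Lemma connect_adjFS F F' x y :
  F \subset F' -> connect (adjF F) x y -> connect (adjF F') x y.
Proof.
move=> /fintype.subsetP sFF'.
apply: (connect_ind (P := connect (adjF F') x)); first exact: connect0.
move=> u v xu /adjFP[e eF [iu <-]].
exact: connect_trans xu (connect_other (sFF' _ eF) iu).
Qed.

(** A vertex set grown from [x0] one vertex at a time gains at least one inner edge of [F] at each
    step, namely the edge that leads to the new vertex. *)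
Lemma connected_card F :
  (forall x y, connect (adjF F) x y) -> #|V| <= #|F|.+1.
Proof.
move=> conn; case: (pickP (mem V)) => [x0 _|V0]; last by rewrite (eq_card0 V0).
pose inner (W : {set V}) := [set e in F | (eu e \in W) && (ev e \in W)].
suff [W xW <-]: exists2 W : {set V}, #|W| <= #|inner W|.+1 & #|W| = #|V|.
  by apply: leq_trans xW _; rewrite ltnS subset_leq_card //;
    apply/fintype.subsetP => e; rewrite inE => /andP[].
suff: forall n, 0 < n <= #|V| ->
    exists W : {set V}, [/\ x0 \in W, #|W| <= #|inner W|.+1 & #|W| = n].
  move=> /(_ #|V|); rewrite leqnn andbT => -[|W [_ ? ?]]; last by exists W.
  by apply/card_gt0P; exists x0.
elim=> // -[_ _|n IH /= ltnV].
  by exists [set x0]; rewrite set11 cards1.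
have [W [x0W leW cW]] := IH (ltnW ltnV).
have [y yW]: exists y, y \notin W.
  apply/existsP; rewrite -negb_forall; apply: contraL ltnV => /forallP WT.
  by rewrite -cW -leqNgt subset_leq_card //; apply/fintype.subsetP => z _; apply: WT.
have [u [v [uW vW /adjFP[e eF [iu vE]]]]] := connect_exit (conn x0 y) x0W yW.
exists (v |: W); split; first by rewrite !inE x0W orbT.
  rewrite cardsU1 vW add1n ltnS; apply: leq_trans leW _.
  apply: proper_card; apply/fintype.properP; split.
    by apply/fintype.subsetP => f; rewrite !inE => /and3P[-> -> ->]; rewrite !orbT.
  have [uvE|uvE] : (eu e = u /\ ev e = v) \/ (eu e = v /\ ev e = u).
  - move: iu vE; rewrite /inc /other.
    by case: (eqVneq (eu e) u) => [-> _ ->|_ /= /eqP -> ->]; [left|right].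
  - by exists e; rewrite !inE eF; case: uvE => -> ->;
      rewrite ?uW ?eqxx ?orbT ?(negPf vW) ?andbF.
  - by exists e; rewrite !inE eF; case: uvE => -> ->;
      rewrite ?uW ?eqxx ?orbT ?(negPf vW) ?andbF.
by rewrite cardsU1 vW cW.
Qed.

(* [side] distinguishes the two components left by the removal of [e]. *)
Lemma tree_side e : is_tree eu ev ->
  exists side : V -> bool,
    forall f x, inc f x -> side (other f x) = side x (+) (f == e).
Proof.
move=> [_ [conn card]]; pose F := [set~ e].
have bridge : ~~ connect (adjF F) (eu e) (ev e).
  apply/negP => Ce; suff /connected_card : forall x y, connect (adjF F) x y.
    (* The count reads [#|V| <= #|Ed|.-1.+1], which contradicts [#|Ed|.+1 = #|V|] only because [e]
       itself shows that there is an edge. *)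
    by rewrite cardsC1 -card; case: #|Ed| (fintype0 e) => [/(_ erefl)[]|n _] //=;
      rewrite ltnn.
  move=> x y; apply: (connect_ind (P := connect (adjF F) x)) (conn x y) => //.
  move=> u v xu /adjFP[f _ [iu <-]].
  apply: connect_trans xu _; case: (eqVneq f e) => [fe|ne].
    move: iu; rewrite fe /other /inc; case: (eqVneq (eu e) u) => [<- //|_] /= /eqP<-.
    by rewrite connect_adjF_sym.
  by apply: connect_other; rewrite ?inE.
exists (connect (adjF F) (eu e)) => f x ix.
case: (eqVneq f e) => [fe|ne]; last first.
  rewrite addbF; apply: same_connect_r; first exact: connect_adjF_sym.
  by rewrite connect_adjF_sym; apply: connect_other; rewrite ?inE.
rewrite addbT; subst f; move: ix; rewrite /inc /other.
case: (eqVneq (eu e) x) => [<- _|_ /= /eqP<-].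
  by rewrite connect0 (negPf bridge).
by rewrite connect0 (negPf bridge).
Qed.

(** A walk is the list of its edges, so that multiplicities are plain counts. Incidence is tested at
    each step because [other e x] is the meaningless value [eu e] when [e] does not touch [x]. *)
Fixpoint walk x p := if p is e :: p' then inc e x && walk (other e x) p' else true.
Definition wend x p := foldl (fun y e => other e y) x p.

Lemma walk_cat x p q : walk x (p ++ q) = walk x p && walk (wend x p) q.
Proof. by elim: p x => //= e p IH x; rewrite IH andbA. Qed.

Lemma wend_cat x p q : wend x (p ++ q) = wend (wend x p) q.
Proof. exact: foldl_cat. Qed.

Lemma walk_connect F x p :
  walk x p -> {subset p <= F} -> connect (adjF F) x (wend x p).
Proof.
elim: p x => //= e p IH x /andP[ix wp] sF.
have eF : e \in F by apply/sF/mem_head.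
apply: connect_trans (connect_other eF ix) (IH _ wp _) => f fp.
by apply: sF; rewrite inE fp orbT.
Qed.

Lemma walk_parity e (side : V -> bool) x p :
  (forall f y, inc f y -> side (other f y) = side y (+) (f == e)) ->
  walk x p -> side (wend x p) = side x (+) odd (count_mem e p).
Proof.
move=> sideP; elim: p x => [|f p IH] x /=; first by rewrite addbF.
by case/andP=> ix wp; rewrite IH // sideP // oddD oddb addbA.
Qed.

(** Each use of [e] changes the side and no other edge does; a closed walk returns to the side where
    it began. *)
Lemma closed_walk_even e x p :
  is_tree eu ev -> walk x p -> wend x p = x -> ~~ odd (count_mem e p).
Proof.
move=> /(tree_side e)[side sideP] wp px; have := walk_parity sideP wp.
by rewrite px; case: (side x); case: odd.
Qed.

(** Unlike [subtreeA], this admits the empty set, the support of the empty walk. Testing one end of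
    each edge is enough, since the edge itself leads to the other. *)
Definition rooted x F := [forall e in F, connect (adjF F) x (eu e)].

Lemma rooted_connect F x e y :
  rooted x F -> e \in F -> inc e y -> connect (adjF F) x y.
Proof.
move=> /forall_inP rF eF iy; apply: connect_trans (rF _ eF) _.
have iu : inc e (eu e) by rewrite /inc eqxx.
by case: (inc_cases iu iy) => -> //; apply: connect_other.
Qed.

Lemma walk_rooted x p : walk x p -> rooted x [set e in p].
Proof.
move=> wp; apply/forall_inP => e; rewrite inE => ep.
case/splitPr: ep wp => p1 p2; rewrite walk_cat /= => /and3P[w1 ie _].
set F := [set _ in _]; have eF : e \in F by rewrite inE mem_cat mem_head orbT.
have iu : inc e (eu e) by rewrite /inc eqxx.
apply: connect_trans (walk_connect (F := F) w1 _) _.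
  by move=> f fp; rewrite inE mem_cat fp.
by case: (inc_cases ie iu) => -> //; apply: connect_other.
Qed.

Definition visited x p : {set V} :=
  [set z | [exists i : 'I_(size p).+1, wend x (take i p) == z]].

Lemma visitedP x p z :
  reflect (exists p1 p2, p = p1 ++ p2 /\ wend x p1 = z) (z \in visited x p).
Proof.
rewrite inE; apply: (iffP existsP) => [[i /eqP<-]|[p1 [p2 [-> <-]]]].
  by exists (take i p), (drop i p); rewrite cat_take_drop.
have lt : size p1 < (size (p1 ++ p2)).+1 by rewrite ltnS size_cat leq_addr.
by exists (Ordinal lt); rewrite /= take_size_cat.
Qed.

Lemma visited_edge x p e z :
  walk x p -> e \in p -> inc e z -> z \in visited x p.
Proof.
move=> wp ep iz; apply/visitedP; case/splitPr: ep wp => p1 p2.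
rewrite walk_cat /= => /and3P[_ ie _]; case: (inc_cases ie iz) => ->.
  by exists p1, (e :: p2).
by exists (rcons p1 e), p2; rewrite cat_rcons -cats1 wend_cat.
Qed.

(* Detours back and forth along an edge can be inserted into a walk whenever
   the edge touches it, so the edges can be added in order of growing distance. *)
Lemma walk_detours x p (k : Ed -> nat) :
  walk x p -> rooted x [set e | (e \in p) || (0 < k e)] ->
  exists q, [/\ walk x q, wend x q = wend x p &
                forall e, count_mem e q = count_mem e p + (k e).*2].
Proof.
(* Induction on the number of detours still to be inserted. *)
move: {2}(\sum_e k e) (erefl (\sum_e k e)) => n; elim: n p k => [|n IH] p k kn wp rF.
  exists p; split=> // e; move/eqP: kn; rewrite sum_nat_eq0 => /forallP/(_ e)/eqP->.
  by rewrite addn0.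
have [e0 k0]: exists e0, 0 < k e0.
  apply/existsP; rewrite -[[exists e, _]]negbK negb_exists; apply/negP => /forallP k0.
  by move: kn; rewrite big1 // => e _; apply/eqP; rewrite -leqn0 leqNgt.
set F := [set e | _] in rF.
(* If [eu e0] is not on the walk, a path in [F] from [x] to it leaves the visited vertices along an
   edge outside [p], which must then have detours left. *)
have [f [z [kf zW iz]]]: exists f z, [/\ 0 < k f, z \in visited x p & inc f z].
  have i0 : inc e0 (eu e0) by rewrite /inc eqxx.
  have [uW|uW] := boolP (eu e0 \in visited x p); first by exists e0, (eu e0).
  have e0F : e0 \in F by rewrite inE k0 orbT.
  have xW : x \in visited x p by apply/visitedP; exists [::], p.
  have [u [v [uW' vW /adjFP[f fF [iu vE]]]]] :=
    connect_exit (rooted_connect rF e0F i0) xW uW.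
  exists f, u; split=> //; move: fF; rewrite inE => /orP[fp|//].
  by rewrite -vE (visited_edge wp fp (inc_other iu)) in vW.
have /visitedP[p1 [p2 [pE zE]]] := zW.
pose k' g := k g - (g == f).
have kk' g : k g = k' g + (g == f).
  by rewrite /k' subnK //; case: eqP => // ->.
have wE : wend x (p1 ++ f :: f :: p2) = wend x p.
  by rewrite pE !wend_cat /= zE otherK.
have cE g : count_mem g (p1 ++ f :: f :: p2) = count_mem g p + (g == f).*2.
  by rewrite pE !count_cat /= (eq_sym f g) -addnn; lia.
have memE g : (g \in p1 ++ f :: f :: p2) = (g \in p) || (g == f).
  by rewrite pE !mem_cat !inE; case: (g == f); case: (g \in p1); case: (g \in p2).
have [|||q [wq eq cq]] := IH (p1 ++ f :: f :: p2) k'.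
- have s1 : \sum_g (g == f) = 1.
    by rewrite (bigD1 f) //= eqxx big1 // => g /negPf->.
  by move: kn; rewrite (eq_bigr _ (fun g _ => kk' g)) big_split /= s1 addn1 => -[].
- by move: wp; rewrite pE !walk_cat /= zE iz inc_other // otherK.
- rewrite (_ : [set e | _] = F) //; apply/setP => g; rewrite !inE memE kk'.
  by case: (eqVneq g f) => [->|_]; rewrite ?addn0 ?orbF // addn1 !orbT.
exists q; split=> //; first by rewrite eq wE.
by move=> g; rewrite cq cE kk' doubleD; lia.
Qed.

End Graph.

(** * Sums over subsets *)

Section SubsetSums.
Local Open Scope ring_scope.
Variables (I : finType) (R : comNzRingType).
Implicit Types (A B G : {set I}) (z : I -> R).

Lemma sum_subset_prod A B z : A \subset B ->
  \sum_(G : {set I} | (A \subset G) && (G \subset B)) \prod_(i in G) z i =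
  \prod_(i in A) z i * \prod_(i in B :\: A) (1 + z i).
Proof.
move=> /fintype.subsetP sAB.
(* When the product of the [a i + b i] is expanded, choosing [a] on [G] and [b] off it gives zero
   unless [G] lies between [A] and [B]. *)
pose a i := if i \in B then z i else 0; pose b i : R := (i \notin A)%:R.
transitivity (\prod_i (a i + b i)); last first.
  rewrite [in RHS]big_mkcond [X in _ * X]big_mkcond -big_split /=.
  apply: eq_bigr => i _; rewrite /a /b !inE.
  by case: (boolP (i \in A)) => [/sAB->|_]; case: (i \in B) => /=; ring.
rewrite bigA_distr big_mkcond; apply: eq_bigr => G _.
case: ifP => [/andP[/fintype.subsetP sAG /fintype.subsetP sGB]|/negbT].
  rewrite big_mkcond; apply: eq_bigr => i _; rewrite /a /b.
  case: ifP => [/sGB->//|/negbT iG].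
  by rewrite (contra (sAG i) iG).
rewrite negb_and => /orP[] /fintype.subsetPn[i iX iY]; rewrite (bigD1 i) //=.
  by rewrite (negPf iY) /b iX mul0r.
by rewrite iX /a (negPf iY) mul0r.
Qed.

(** Moebius inversion on the subset lattice: with all [z i] equal to -1, each element of [B :\: A]
    contributes a factor [1 - 1]. *)
Lemma sum_signed_interval A B :
  \sum_(G : {set I} | (A \subset G) && (G \subset B)) (-1) ^+ (#|B| + #|G|)
  = (A == B)%:R :> R.
Proof.
have [sAB|nAB] := boolP (A \subset B); last first.
  rewrite big_pred0 => [|G]; last first.
    by apply/negP => /andP[/fintype.subset_trans/[apply]]; apply/negP.
  by case: eqP nAB => // ->; rewrite fintype.subxx.
under eq_bigr => G _ do rewrite exprD -(prodr_const (mem G)).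
rewrite -big_distrr sum_subset_prod //= prodr_const addrN prodr_const expr0n.
rewrite mulrA -exprD cards_eq0 finset.setD_eq0 finset.eqEsubset sAB /=.
case: (boolP (B \subset A)) => [sBA|_]; last by rewrite mulr0.
have -> : A = B by apply/eqP; rewrite finset.eqEsubset sAB.
by rewrite addnn -signr_odd odd_double mulr1.
Qed.

(** The left side has the shape of the bracket in [cG]. The weight [#|B| - #|S|] counts the [i] in
    [B] outside [S], and marking such an [i] leaves [S] free in [B :\ i]. The set [S = B], absent on
    the left, has weight zero. *)
Lemma sum_esym_weighted B z :
  \sum_(j < #|B|) (#|B| - j)%:R *
     (\sum_(S : {set I} | (S \subset B) && (#|S| == j)) \prod_(i in S) z i)
  = \sum_(i in B) \prod_(k in B :\ i) (1 + z k).
Proof.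
have expand i : \prod_(k in B :\ i) (1 + z k) =
    \sum_(S : {set I} | S \subset B :\ i) \prod_(k in S) z k.
  have := @sum_subset_prod finset.set0 (B :\ i) z (finset.sub0set _).
  rewrite big_set0 mul1r finset.setD0 => <-.
  by apply: eq_bigl => S; rewrite finset.sub0set.
under [RHS]eq_bigr => i _ do rewrite expand.
rewrite [RHS](exchange_big_dep (fun S : {set I} => S \subset B)) /=; last first.
  by move=> i S _; rewrite finset.subsetD1 => /andP[].
under eq_bigr => j _ do rewrite big_distrr /=.
rewrite (exchange_big_dep (fun S : {set I} => S \subset B)) /=; last first.
  by move=> j S _ /andP[].
apply: eq_bigr => S SB.
rewrite [RHS](eq_bigl (fun i => i \in B :\: S)); last first.
  by move=> i; rewrite finset.subsetD1 SB !inE andbC.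
rewrite sumr_const cardsD (finset.setIidPr SB) -mulr_natl.
have [ltSB|geSB] := ltnP #|S| #|B|.
  by rewrite (big_pred1 (Ordinal ltSB)) // => j; rewrite SB /= eq_sym.
rewrite big_pred0 => [|j].
  by move: geSB; rewrite -subn_eq0 => /eqP->; rewrite mul0r.
by rewrite SB /=; apply/negP => /eqP Sj; move: (ltn_ord j); rewrite -Sj ltnNge geSB.
Qed.

End SubsetSums.

(** * Branches at a vertex *)

Section Branches.
Variables (V Ed : finType) (eu ev : Ed -> V) (A : V).
Hypothesis tree : is_tree eu ev.
Implicit Types (e f g : Ed) (x y z : V) (F G B : {set Ed}).
Local Notation inc := (inc eu ev).
Local Notation other := (other eu ev).
Local Notation adjF := (adjF eu ev).
Local Notation branch := (branch eu ev A).
Local Notation Aedges := (Aedges eu ev A).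
Local Notation rooted := (rooted eu ev A).

Lemma branch_refl e : e \in branch e.
Proof. by rewrite inE connect0. Qed.

Lemma branch_share e f g x :
  f \in branch e -> x != A -> inc f x -> inc g x -> g \in branch e.
Proof.
rewrite !inE => ef xA fx gx; apply: connect_trans ef (connect1 _).
by apply/existsP; exists x; rewrite xA fx gx.
Qed.

Lemma share_notA_sym : symmetric (share_notA eu ev A).
Proof. by move=> f g; apply: eq_existsb => x; rewrite andbAC. Qed.

(** Consecutive edges of a branch meet away from [A], so the chain never gets back across [e] to the
    side of [A]; an edge at [A] whose other end is on the far side can only be [e]. *)
Lemma branch_Aedge e f : e \in Aedges -> f \in Aedges -> f \in branch e -> f = e.
Proof.
rewrite !inE => eA fA ef.
have [side sideP] := tree_side e tree.
have far : exists x, [/\ x != A, inc f x & side x != side A].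
  apply: (connect_ind 
    (P := fun g => exists x, [/\ x != A, inc g x & side x != side A])) ef.
    exists (other e A); rewrite inc_other // sideP // eqxx addbT.
    split=> //; last by case: (side A).
    by apply/eqP => H; have := sideP e A eA; rewrite H eqxx; case: (side A).
  move=> g h [x [xA gx sx]] /existsP[y /andP[/andP[yA gy] hy]].
  exists y; split=> //.
  have [->//|yE] := inc_cases gx gy; subst y.
  (* One end of [e] is [A], so [e] cannot carry the chain from [x] to another vertex [y] when both
     differ from [A]. *)
  have [ge|ge] := eqVneq g e; last by rewrite sideP // (negPf ge) addbF.
  subst g; have [AE|AE] := inc_cases gx eA; first by rewrite AE eqxx in xA.
  by rewrite -AE eqxx in yA.
have [x [xA fx sx]] := far; apply/eqP.
have [xE|xE] := inc_cases fA fx; first by rewrite xE eqxx in xA.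
by move: sx; rewrite xE sideP //; case: (f == e) => //; rewrite addbF eqxx.
Qed.

Lemma branch_uniq e e' f : e \in Aedges -> e' \in Aedges ->
  f \in branch e -> f \in branch e' -> e = e'.
Proof.
move=> eA e'A fe fe'; apply/esym/branch_Aedge => //.
move: fe fe'; rewrite !inE => fe fe'; apply: connect_trans fe _.
by rewrite (sym_connect_sym share_notA_sym).
Qed.

(** Along a path in [F] from [A], the relevant branch is that of the last edge used to leave [A];
    every visit to [A] restarts it. *)
Lemma rooted_branch F f : rooted F -> f \in F ->
  exists e, [/\ e \in Aedges, e \in F, f \in branch e &
                connect (adjF (F :&: branch e)) A (eu f)].
Proof.
move=> /forall_inP rF fF.
(* The invariant keeps an edge [g] of the branch at the current vertex, through which the next edge
   is seen to lie in the same branch. *)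
have reach : eu f = A \/ exists e, [/\ e \in Aedges, e \in F,
    connect (adjF (F :&: branch e)) A (eu f) & exists2 g, g \in branch e & inc g (eu f)].
  apply: (connect_ind (P := fun x => x = A \/ exists e, [/\ e \in Aedges, e \in F,
    connect (adjF (F :&: branch e)) A x &
    exists2 g, g \in branch e & inc g x])) (rF _ fF).
    by left.
  move=> x y xP /adjFP[g gF [gx <-]]; right.
  have [xA|xA] := eqVneq x A.
    subst x; have gb := branch_refl g; exists g; split=> //; first by rewrite inE.
      by apply: connect_other; rewrite // finset.in_setI gF.
    by exists g; rewrite // inc_other.
  have [e [eA eF cx [h he hx]]] : exists e, [/\ e \in Aedges, e \in F,
    connect (adjF (F :&: branch e)) A x & exists2 g, g \in branch e & inc g x].
    by case: xP => // xE; rewrite xE eqxx in xA.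
  have ge := branch_share he xA hx gx.
  exists e; split=> //; last by exists g; rewrite // inc_other.
  by apply: connect_trans cx (connect_other _ gx); rewrite finset.in_setI gF.
have fu : inc f (eu f) by rewrite /Defs.inc eqxx.
have [fA|fA] := eqVneq (eu f) A.
  exists f; split=> //; first by rewrite inE -fA.
    exact: branch_refl.
  by rewrite fA connect0.
case: reach => [fE|[e [eA eF cf [g ge gf]]]]; first by rewrite fE eqxx in fA.
by exists e; split=> //; apply: branch_share ge fA gf fu.
Qed.

Lemma branch_cover f : exists2 e, e \in Aedges & f \in branch e.
Proof.
have rT : rooted finset.setT by apply/forall_inP => e _; case: tree => _ [].
by have [e [eA _ fe _]] := rooted_branch rT (finset.in_setT f); exists e.
Qed.

(** Rootedness is a condition on each branch separately, which lets signed sums over rooted sets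
    factor. *)
Lemma rooted_cap F :
  rooted F = [forall e in Aedges, rooted (F :&: branch e)].
Proof.
apply/idP/forall_inP => [rF e eA|rF].
  apply/forall_inP => f /finset.setIP[fF fe].
  have [e' [e'A _ fe' ?]] := rooted_branch rF fF.
  by rewrite (branch_uniq eA e'A fe fe').
apply/forall_inP => f fF; have [e eA fe] := branch_cover f.
have /forall_inP/(_ f) := rF e eA; rewrite finset.in_setI fF fe => /(_ isT).
exact/connect_adjFS/finset.subsetIl.
Qed.

(** A rooted set can enter a branch only through the edge of that branch at [A]. *)
Lemma cap_branch_eq0 F e : rooted F -> e \in Aedges ->
  (F :&: branch e == finset.set0) = (e \notin F).
Proof.
move=> rF eA; apply/eqP/idP => [F0|eF].
  apply/negP => eF; have := finset.in_set0 e.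
  by rewrite -F0 finset.in_setI eF branch_refl.
apply/finset.setP => f; rewrite [RHS]inE; apply: contraNF eF => /finset.setIP[fF fe].
have [e' [e'A e'F fe' _]] := rooted_branch rF fF.
by rewrite (branch_uniq eA e'A fe fe').
Qed.

Lemma sub_cap F G : (G \subset F) =
  [forall e in Aedges, G :&: branch e \subset F :&: branch e].
Proof.
apply/idP/forall_inP => [sGF e _|sGF]; first exact: finset.setSI.
apply/fintype.subsetP => f fG; have [e eA fe] := branch_cover f.
have /fintype.subsetP/(_ f) := sGF e eA; rewrite !finset.in_setI fG fe.
by case/(_ isT)/andP.
Qed.

Lemma card_cap F : #|F| = \sum_(e in Aedges) #|F :&: branch e|.
Proof.
under [RHS]eq_bigr => e _ do rewrite -sum1_card.
rewrite (exchange_big_dep (mem F)) /=; last by move=> e f _ /finset.setIP[].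
rewrite -sum1_card; apply: eq_bigr => f fF.
have [e eA fe] := branch_cover f.
rewrite (big_pred1 e) // => e'; rewrite finset.in_setI fF /=.
apply/andP/eqP => [[e'A fe']|-> //]; exact: branch_uniq fe' fe.
Qed.

Local Open Scope ring_scope.

(** Since the branches partition the edges, choosing a subset of each branch amounts to choosing one
    edge set [F]. *)
Lemma prod_branch (R : comNzRingType) (h : Ed -> {set Ed} -> R) :
  \prod_(e in Aedges) \sum_(F : {set Ed} | F \subset branch e) h e F =
  \sum_F \prod_(e in Aedges) h e (F :&: branch e).
Proof.
rewrite (big_distr_big_dep finset.set0) /=.
pose glue (f : {ffun Ed -> {set Ed}}) := \bigcup_(e in Aedges) f e.
pose cut F := [ffun e => if e \in Aedges then F :&: branch e else finset.set0].
rewrite (reindex_onto cut glue) /=; last first.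
  move=> f /pfamilyP[/fintype.subsetP sf fB]; apply/ffunP => e; rewrite ffunE.
  case: ifPn => [eA|neA]; last first.
    by apply/esym/eqP; apply: contraNT neA => fe; apply: sf; rewrite inE.
  apply/finset.setP => g; rewrite finset.in_setI.
  apply/andP/idP => [[/bigcupP[e' e'A ge'] ge]|ge].
    have /fintype.subsetP/(_ _ ge') ge'' := fB e' e'A.
    by rewrite (branch_uniq eA e'A ge ge'').
  split; first by apply/bigcupP; exists e.
  by have /fintype.subsetP := fB e eA; apply.
apply: eq_big => [F|F _].
  apply/andP; split.
    apply/pfamilyP; split.
      apply/fintype.subsetP => e; rewrite !inE ffunE.
      by case: ifP => [|_]; rewrite ?eqxx // inE.
    by move=> e eA; rewrite ffunE eA unfold_in finset.subsetIr.
  apply/eqP/finset.setP => g; apply/bigcupP/idP => [[e eA]|gF].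
    by rewrite ffunE eA finset.in_setI => /andP[].
  have [e eA ge] := branch_cover g.
  by exists e; rewrite // ffunE eA finset.in_setI gF.
by apply: eq_bigr => e eA; rewrite ffunE eA.
Qed.

End Branches.

(** * The coefficients c_G *)

Section Coefficients.
Variables (V Ed : finType) (eu ev : Ed -> V) (A : V).
Hypothesis tree : is_tree eu ev.
Implicit Types (e f g : Ed) (x y z : V) (F G B S : {set Ed}).
Local Notation branch := (branch eu ev A).
Local Notation Aedges := (Aedges eu ev A).
Local Notation rooted := (rooted eu ev A).
Local Open Scope ring_scope.

Lemma rooted0 : rooted finset.set0.
Proof. by apply/forall_inP => e; rewrite finset.in_set0. Qed.

(** Stated through whole branches so that it can be tested factor by factor; for rooted [F] these
    are the edges at [A] outside [F]. *)
Definition missing F := [set e in Aedges | F :&: branch e == finset.set0].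

(* For [b = false], [F'] runs over all rooted subtrees of the branch at [e] that
   contain [G :&: branch e], the empty one included; [b = true] forces [F'] to
   be empty. *)
Definition local_term G (b : bool) e F' : int :=
  ([&& rooted F', G :&: branch e \subset F' & b ==> (F' == finset.set0)])%:R *
  (-1) ^+ (#|F'| + #|G :&: branch e|).

Lemma sum_local_termT G e :
  \sum_(F : {set Ed} | F \subset branch e) local_term G true e F =
  (G :&: branch e == finset.set0)%:R.
Proof.
rewrite (bigD1 finset.set0) ?finset.sub0set //= big1 => [|F /andP[_ /negPf F0]].
  rewrite /local_term rooted0 eqxx andbT finset.subset0 cards0 add0n addr0.
  by case: eqP => [->|_]; rewrite ?cards0 ?mulr1 ?mul0r.
by rewrite /local_term F0 /= !andbF mul0r.
Qed.

(** The empty set, which [zz] leaves out, gives the first summand. *)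
Lemma sum_local_termF G e :
  \sum_(F : {set Ed} | F \subset branch e) local_term G false e F =
  (G :&: branch e == finset.set0)%:R + zz eu ev A (branch e) (G :&: branch e).
Proof.
rewrite (bigD1 finset.set0) ?finset.sub0set //=; congr (_ + _).
  rewrite /local_term rooted0 andbT finset.subset0 cards0 add0n.
  by case: eqP => [->|_]; rewrite ?cards0 ?mulr1 ?mul0r.
rewrite /zz mulr_sumr big_mkcond [RHS]big_mkcond; apply: eq_bigr => F _.
rewrite /local_term andbT /subtreeA -/(rooted F) exprD.
case: (F \subset _); case: (F != _); case: (rooted F); case: (_ \subset F);
  rewrite /= ?mul0r ?mul1r //; exact: mulrC.
Qed.

Lemma prod_local_term G F e0 : e0 \in Aedges ->
  \prod_(e in Aedges) local_term G (e == e0) e (F :&: branch e) =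
  ([&& rooted F, G \subset F & e0 \in missing F])%:R * (-1) ^+ (#|F| + #|G|).
Proof.
move=> e0A; have [|ncond] := boolP [&& _, _ & _].
  rewrite (rooted_cap A tree) (sub_cap A tree) inE e0A.
  case/and3P=> /forall_inP rF /forall_inP sGF /= F0.
  rewrite mul1r (card_cap A tree F) (card_cap A tree G) -big_split /= expr_sum.
  apply: eq_bigr => e eA; rewrite /local_term rF ?sGF //=.
  by case: eqP => [->|_]; rewrite ?(andTb, F0) /= mul1r.
suff [e eA e0E] : exists2 e, e \in Aedges & local_term G (e == e0) e (F :&: branch e) = 0.
  by rewrite (bigD1 e) //= e0E !mul0r.
move: ncond; rewrite !negb_and => /or3P[].
- rewrite (rooted_cap A tree) => /forall_inPn[e eA nr]; exists e => //.
  by rewrite /local_term (negPf nr) mul0r.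
- rewrite (sub_cap A tree) => /forall_inPn[e eA nr]; exists e => //.
  by rewrite /local_term (negPf nr) andbF mul0r.
- rewrite inE e0A /= => nr; exists e0 => //.
  by rewrite /local_term eqxx (negPf nr) !andbF mul0r.
Qed.

(** The factor [#|missing F|] comes from marking one missing edge [e0]. For fixed [e0] the sum over
    [F] factors: an unmarked branch gives [zz] if it meets [G] and [1 + zi] otherwise, and the
    marked one gives 0 or 1 respectively. *)
Lemma cG_rooted G : cG eu ev A G =
  \sum_(F : {set Ed} | rooted F && (G \subset F)) (-1) ^+ (#|F| + #|G|) * #|missing F|%:R.
Proof.
pose K := [set e in Aedges | G :&: branch e != finset.set0].
pose J := Aedges :\: K.
have KE e : (e \in K) = (e \in Aedges) && (G :&: branch e != finset.set0).
  exact: finset.in_set.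
have JE e : (e \in J) = (e \in Aedges) && (G :&: branch e == finset.set0).
  by rewrite finset.in_setD KE; case: (e \in Aedges); rewrite ?andbF ?andbT ?negbK.
have KJ (h : Ed -> int) :
    \prod_(e in Aedges) h e = \prod_(e in K) h e * \prod_(e in J) h e.
  rewrite (big_setID K) /=; congr (_ * _); apply: eq_bigl => e.
  by rewrite finset.in_setI KE; case: (e \in Aedges).
transitivity (\sum_(e0 in Aedges) \prod_(e in Aedges)
    \sum_(F : {set Ed} | F \subset branch e) local_term G (e == e0) e F); last first.
  under eq_bigr => e0 e0A.
    rewrite (prod_branch A tree (fun e => local_term G (e == e0) e)).
    under eq_bigr => F _ do rewrite prod_local_term //.
    over.
  rewrite exchange_big [RHS]big_mkcond; apply: eq_bigr => F _ /=.
  case: ifPn => [/andP[rF GF]|nFG]; last first.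
    by rewrite big1 // => e _; rewrite andbA (negPf nFG) mul0r.
  rewrite rF GF /= -mulr_suml mulrC; congr (_ * _).
  rewrite -natr_sum -sum1_card; congr (_%:R).
  rewrite big_mkcond [RHS]big_mkcond; apply: eq_bigr => e _.
  rewrite [_ \in missing F]finset.in_set.
  by case: (e \in Aedges) => /=; case: (F :&: branch e == finset.set0).
have termJ e0 :
    \prod_(e in Aedges) \sum_(F : {set Ed} | F \subset branch e) local_term G (e == e0) e F
    = (e0 \notin K)%:R * (\prod_(e in K) zz eu ev A (branch e) (G :&: branch e) *
    \prod_(e in J :\ e0) (1 + zi eu ev A e)).
  have [e0K|e0K] := boolP (e0 \in K).
    have /[!KE] /andP[e0A /negPf G0] := e0K.
    by rewrite (bigD1 e0) //= eqxx sum_local_termT G0 !mul0r.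
  rewrite mul1r KJ; congr (_ * _).
    apply: eq_bigr => e eK; have /[!KE] /andP[eA /negPf G0] := eK.
    case: (eqVneq e e0) => [ee0|_]; first by rewrite -ee0 eK in e0K.
    by rewrite sum_local_termF G0 add0r.
  rewrite [LHS]big_mkcond [RHS]big_mkcond; apply: eq_bigr => e _.
  rewrite in_setD1 JE; case: (e \in Aedges); rewrite ?andbF //=.
  case: (eqVneq (G :&: branch e) finset.set0) => [G0|_]; last by rewrite andbF.
  case: (eqVneq e e0) => [_|_] /=.
    by rewrite sum_local_termT G0 eqxx.
  by rewrite sum_local_termF G0 eqxx.
under [RHS]eq_bigr => e0 _ do rewrite termJ.
rewrite /cG -/K -/J (_ : \sum_(j < #|J|) _ =
    \sum_(i in J) \prod_(k in J :\ i) (1 + zi eu ev A k)).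
  rewrite mulr_sumr big_mkcond [RHS]big_mkcond; apply: eq_bigr => e _.
  rewrite finset.in_setD; case: (e \in Aedges); case: (e \in K) => //=; rewrite ?mul0r //.
  by rewrite mul1r.
rewrite -sum_esym_weighted; apply: eq_bigr => j _.
by rewrite /esym natz.
Qed.

(** After the sums are exchanged, the signed sum over all [G] between [S] and [F] vanishes unless
    [F = S]. *)
Lemma sum_cG S :
  \sum_(G : {set Ed} | S \subset G) cG eu ev A G =
  (rooted S)%:R * #|[set e in Aedges | e \notin S]|%:R.
Proof.
under eq_bigr => G _ do rewrite cG_rooted.
rewrite (exchange_big_dep rooted) /=; last by move=> G F _ /andP[].
under eq_bigr => F rF.
  rewrite -mulr_suml (eq_bigl (fun G => (S \subset G) && (G \subset F))); last first.
    by move=> G; rewrite rF.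
  rewrite sum_signed_interval.
  over.
rewrite big_mkcond (bigD1 S) //= eqxx big1 => [|F FS]; last first.
  by rewrite eq_sym (negPf FS) mul0r if_same.
rewrite addr0 mul1r; case: ifP => rS; last by rewrite mul0r.
rewrite mul1r; congr (_%:R); apply: eq_card => e; rewrite !inE.
by case: (boolP (Defs.inc _ _ _ _)) => //= eA; rewrite (cap_branch_eq0 tree) // inE.
Qed.

End Coefficients.

(** * Times and births *)

Section Dynamics.
Variables (R : realType) (V Ed : finType) (eu ev : Ed -> V) (t : Ed -> R) (A : V).
Hypothesis tree : is_tree eu ev.
Hypothesis t_indep : Qlin_indep t.
Implicit Types (e f : Ed) (x y : V) (p : seq Ed) (n : {ffun Ed -> nat}) (s T : R).
Implicit Types F G : {set Ed}.
Local Notation inc := (inc eu ev).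
Local Notation other := (other eu ev).
Local Notation walk := (walk eu ev).
Local Notation wend := (wend eu ev).
Local Notation Aedges := (Aedges eu ev A).
Local Notation rooted := (rooted eu ev A).
Local Notation active := (active eu ev t A).
Local Open Scope ring_scope.

Lemma activeP x s :
  active x s <-> exists p, [/\ walk A p, wend A p = x & s = \sum_(e <- p) t e].
Proof.
split=> [|[p [wp <- ->]]].
  have step e y p : walk A p -> wend A p = y -> inc e y ->
      exists q, [/\ walk A q, wend A q = other e y &
                    \sum_(f <- p) t f + t e = \sum_(f <- q) t f].
    move=> wp py iy; exists (rcons p e); rewrite -cats1 walk_cat wend_cat /= py wp iy.
    by split=> //; rewrite big_cat big_seq1.
  elim=> {x s} [|e s _ [p [wp px ->]]|e s _ [p [wp px ->]]].
  - by exists [::]; rewrite big_nil.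
  - have iu : inc e (eu e) by rewrite /Defs.inc eqxx.
    by have := step e _ _ wp px iu; rewrite {1}/Defs.other eqxx.
  - have iv : inc e (ev e) by rewrite /Defs.inc eqxx orbT.
    have := step e _ _ wp px iv; rewrite {1}/Defs.other.
    by case: eqP => // <-.
elim/last_ind: p wp => [_|p e IH]; first by rewrite big_nil; apply: active0.
rewrite -cats1 walk_cat wend_cat big_cat big_seq1 /= andbT => /andP[wp].
move: (IH wp); set y := wend A p => ay; rewrite /Defs.inc /Defs.other.
case: (eqVneq (eu e) y) => [ey _|_ /= /eqP ey].
  by apply: active_uv; rewrite ey.
by apply: active_vu; rewrite ey.
Qed.

Definition travel (c : Ed -> nat) : R := \sum_e (c e)%:R * t e.

Lemma travel_walk p : \sum_(e <- p) t e = travel (fun e => count_mem e p).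
Proof.
rewrite /travel; elim: p => [|f p IH].
  by rewrite big_nil big1 // => e _; rewrite mul0r.
rewrite big_cons IH /=; under [RHS]eq_bigr => e _ do rewrite natrD mulrDl.
rewrite big_split /= [X in _ = X + _](bigD1 f) //= eqxx mul1r.
by rewrite [X in _ + X + _]big1 ?addr0 // => e /negPf; rewrite eq_sym => ->; rewrite mul0r.
Qed.

Lemma eq_travel (a b : Ed -> nat) : a =1 b -> travel a = travel b.
Proof. by move=> ab; apply: eq_bigr => e _; rewrite ab. Qed.

Lemma travelD (a b : Ed -> nat) :
  travel (fun e => (a e + b e)%N) = travel a + travel b.
Proof.
by rewrite -big_split; apply: eq_bigr => e _; rewrite natrD mulrDl.
Qed.

Lemma travel_double (a : Ed -> nat) : travel (fun e => (a e).*2) = 2 * travel a.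
Proof.
rewrite mulr_sumr; apply: eq_bigr => e _.
by rewrite -muln2 natrM mulrA [_ * 2%:R]mulrC.
Qed.

Lemma travel1 e : travel (fun f => f == e) = t e.
Proof.
rewrite /travel (bigD1 e) //= eqxx mul1r big1 ?addr0 // => f /negPf->.
by rewrite mul0r.
Qed.

(** The differences [a e - b e] are rational coefficients of a vanishing combination of the
    [t e]. *)
Lemma travel_inj (a b : Ed -> nat) : travel a = travel b -> a =1 b.
Proof.
move=> /eqP; rewrite -subr_eq0 /travel -sumrB => /eqP ab e.
have /t_indep/(_ e)/eqP : \sum_e ratr ((a e)%:R - (b e)%:R) * t e = 0.
  by rewrite -[RHS]ab; apply: eq_bigr => f _; rewrite rmorphB /= !ratr_nat mulrBl.
by rewrite subr_eq0 eqr_nat => /eqP.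
Qed.

Definition supp n := [set e | (0 < n e)%N].

Lemma active_root s :
  active A s <-> exists n, rooted (supp n) /\ s = 2 * travel n.
Proof.
rewrite activeP; split=> [[p [wp pA ->]]|[n [rn ->]]].
  exists [ffun e => (count_mem e p)./2].
  have ev2 e : ([ffun e => (count_mem e p)./2] e).*2 = count_mem e p.
    by rewrite ffunE even_halfK // (closed_walk_even e tree wp pA).
  split; last by rewrite travel_walk -travel_double; apply: eq_travel => e; rewrite ev2.
  rewrite (_ : supp _ = [set e in p]); first exact: walk_rooted.
  by apply/setP => e; rewrite !inE -double_gt0 ev2 -has_count has_pred1.
(* The converse starts from the empty walk and inserts [n e] detours along each [e]. *)
have [||q [wq eq cq]] := @walk_detours V Ed eu ev A [::] n; rewrite ?in_nil //.
exists q; split=> //; rewrite travel_walk -travel_double.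
by apply: eq_travel => e; rewrite cq.
Qed.

Lemma arrivals_root n : rooted (supp n) ->
  arrivals eu ev t A A (2 * travel n) = #|Aedges :&: supp n|.
Proof.
move=> rn; apply: eq_card => e; rewrite !inE; case: (boolP (inc e A)) => //= eA.
apply/asboolP/idP => [/activeP[p [wp pe ts]]|n0].
  (* The walk [p] followed by [e] takes time [2 * travel n], so its counts are those of [n] doubled;
     as it uses [e], [n e] is positive. *)
  have : (fun f => count_mem f (rcons p e)) =1 (fun f => (n f).*2).
    apply: travel_inj; rewrite -travel_walk travel_double -cats1 big_cat big_seq1.
    by rewrite -ts /= subrK.
  move=> /(_ e); rewrite -cats1 count_cat /= eqxx.
  by case: (n e) => //; rewrite addnC.
(* The walk starts along [e], and the arrival at [A] along [e] closes that round trip; [k] counts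
   the remaining ones. *)
pose k f := (n f - (f == e))%N.
have nk f : n f = (k f + (f == e))%N.
  by rewrite /k subnK //; case: eqP => // ->.
have [||q [wq eq cq]] := @walk_detours V Ed eu ev A [:: e] k.
- by rewrite /= eA.
- rewrite (_ : [set f | _] = supp n) //; apply/setP => f; rewrite !inE nk.
  by case: (f == e); rewrite ?addn0 ?addn1.
apply/activeP; exists q; split=> //.
apply: (addIr (t e)); rewrite subrK travel_walk -(travel1 e) -travelD -travel_double.
apply: eq_travel => f; rewrite cq nk /= eq_sym; case: (f == e) => /=; lia.
Qed.

Lemma births_root n : rooted (supp n) ->
  births eu ev t A A (2 * travel n) = #|[set e in Aedges | e \notin supp n]|.
Proof.
move=> rn; rewrite /births arrivals_root // /deg -cardsD.
by apply: eq_card => e; rewrite !inE andbC.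
Qed.

(** As the times are positive, each [n e] is at most [T / t e]. The list [r] turns the sums over
    sets of times and tuples into ordinary finite sums. *)
Lemma travel_bounded T : (forall e, 0 < t e) -> exists r : seq {ffun Ed -> nat},
  uniq r /\ forall n, (n \in r) = (2 * travel n <= T).
Proof.
move=> t_gt0; pose M := (\max_e Num.truncn (T / t e))%N.
pose r : seq {ffun Ed -> nat} :=
  [seq [ffun e => val (g e)] | g : {ffun Ed -> 'I_M.+1} <- enum {ffun Ed -> 'I_M.+1}].
exists (undup [seq n : {ffun Ed -> nat} <- r | 2 * travel n <= T]).
split=> [|n]; first exact: undup_uniq.
rewrite mem_undup mem_filter andb_idr // => nT.
have nM e : (n e < M.+1)%N.
  have ne : (n e)%:R * t e <= T.
    apply: le_trans nT; rewrite /travel (bigD1 e) //=.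
    have h1 : 0 <= (n e)%:R * t e by rewrite mulr_ge0 // ltW.
    have h2 : 0 <= \sum_(i | i != e) (n i)%:R * t i.
      by apply: sumr_ge0 => f _; rewrite mulr_ge0 // ltW.
    lra.
  rewrite ltnS; apply: leq_trans (leq_bigmax e).
  have T0 : 0 <= T / t e.
    rewrite divr_ge0 ?(ltW (t_gt0 e)) //; apply: le_trans ne.
    by rewrite mulr_ge0 // ltW.
  by rewrite truncn_ge_nat // ler_pdivlMr.
apply/mapP; exists [ffun e => Ordinal (nM e)]; first by rewrite mem_enum.
by apply/ffunP => e; rewrite !ffunE.
Qed.

(** Linear independence makes [n] the only label of its time, so the active times at [A] up to [T]
    are reindexed by the rooted [n] in [r]. *)
Lemma Nbirths_sum T (r : seq {ffun Ed -> nat}) :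
  uniq r -> (forall n, (n \in r) = (2 * travel n <= T)) ->
  Nbirths eu ev t A A T =
  (\sum_(n <- r | rooted (supp n)) #|[set e in Aedges | e \notin supp n]|)%N.
Proof.
move=> ur rP; rewrite -big_filter /Nbirths.
set r' := filter _ _.
rewrite (fsbig_fwiden [seq 2 * travel n | n : {ffun Ed -> nat} <- r']).
- rewrite big_map; apply: eq_big_seq => n; rewrite mem_filter => /andP[rn _].
  exact: births_root.
- move=> s /= [/active_root[n [rn ->]] sT].
  by apply/mapP; exists n => //; rewrite mem_filter rn rP.
- rewrite map_inj_uniq ?filter_uniq // => n m nm.
  by apply/ffunP; apply: travel_inj; apply: mulfI nm; rewrite pnatr_eq0.
- move=> s /= [/mapP[n + ->] []]; rewrite mem_filter rP => /andP[rn nT].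
  by split=> //; apply/active_root; exists n.
Qed.

(** A tuple indexed by [G] is encoded as an [n] vanishing off [G], that is, with support in [G]. *)
Lemma cntG_sum G T (r : seq {ffun Ed -> nat}) :
  uniq r -> (forall n, (n \in r) = (2 * travel n <= T)) ->
  cntG t G T = (\sum_(n <- r | supp n \subset G) 1)%N.
Proof.
move=> ur rP; rewrite -big_filter /cntG.
have suppE n : (supp n \subset G) <-> forall e, e \notin G -> n e = 0%N.
  split=> [/fintype.subsetP sG e|sG].
    by move=> /(contra (sG e)); rewrite inE lt0n negbK => /eqP.
  apply/fintype.subsetP => e; rewrite inE; apply: contraTT => /sG->.
  by rewrite ltnn.
have travelG n : (forall e, e \notin G -> n e = 0%N) ->
    \sum_(e in G) (n e)%:R * t e = travel n.
  move=> sG; rewrite big_mkcond; apply: eq_bigr => e _.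
  by case: ifP => // /negbT/sG->; rewrite mul0r.
rewrite (fsbig_fwiden [seq n <- r | supp n \subset G]) ?filter_uniq //.
- move=> n /= [sG]; rewrite mem_filter rP => nT.
  by rewrite -travelG // nT andbT; apply/suppE.
- move=> n /= [+ []]; rewrite mem_filter rP => /andP[/suppE sG nT].
  by rewrite travelG.
Qed.

End Dynamics.

Theorem theorem1 (R : realType) (V Ed : finType) (eu ev : Ed -> V)
    (t : Ed -> R) (A : V) (T : R) :
  is_tree eu ev ->
  (forall e, 0 < t e)%R ->
  Qlin_indep t ->
  (0 <= T)%R ->
  ((Nbirths eu ev t A A T)%:Z =
     \sum_(G : {set Ed}) cG eu ev A G * (cntG t G T)%:Z)%R.
Proof.
move=> tree t_gt0 t_indep _.
have [r [ur rP]] := travel_bounded T t_gt0.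
rewrite (Nbirths_sum A tree t_indep ur rP).
under [RHS]eq_bigr => G _ do
  rewrite (cntG_sum G ur rP) -natz natr_sum big_distrr /=.
(* For fixed [n] the coefficients collected are the [cG] with [supp n \subset G], and [sum_cG]
   evaluates their sum. *)
rewrite [RHS](exchange_big_dep xpredT) //= -natz natr_sum big_mkcond.
apply: eq_bigr => n _; rewrite -mulr_suml mulr1 (sum_cG A tree).
by case: (rooted _ _ _ _); rewrite ?mul1r ?mul0r.
Qed.
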